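(* There exist universal constants $C>0$ and $C'\ge 1$ such that the following holds. Suppose $G$ is a finite, connected, transitive $d$-regular graph with path metric $\mathsf{dist}$, let $\{X_t\}_{t\ge0}$ be the simple random walk on $G$ with $X_0$ arbitrary, and let $\lambda$ denote the second-largest eigenvalue of the transition matrix $P$ of this random walk. Then for every $t\le (1-\lambda)^{-1}$, $$\mathbb{E}\left[\mathsf{dist}(X_0,X_t)^2\right]\ \ge\ t/(2d) .$$ Moreover, for all $t$ such that $(1-\lambda)^{-1}\ge t\ge d$, $$\mathbb{E}\left[\mathsf{dist}(X_0,X_t)\right]\ \ge\ C\sqrt{t/d},$$ and for every $\varepsilon\ge 1/\sqrt t$, $$\frac1t\sum_{s=0}^t \mathbb{P}\left[\mathsf{dist}(X_0,X_s)\le \varepsilon\sqrt{t/d}\right]\ \le\ C'\varepsilon .$$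
   Context: A graph is transitive if its automorphism group acts transitively on its vertices. Self-loops are allowed (a loop counts once toward the degree). The simple random walk on a $d$-regular graph traverses at each step a uniformly random one of the $d$ edges at the current vertex; time $t$ is a nonnegative integer. Eigenvalues of the symmetric matrix $P$ are counted with multiplicity. *)

(* Defs.v *)
From HB Require Import structures.
From mathcomp Require Import all_boot all_order all_algebra perm.
From mathcomp Require polyrcf.
From mathcomp Require Import all_classical all_reals all_analysis.

Set Implicit Arguments.
Unset Strict Implicit.
Unset Printing Implicit Defensive.

Import Order.TTheory GRing.Theory Num.Theory.
Local Open Scope classical_set_scope.
Local Open Scope ring_scope.

(* A finite graph is a symmetric relation [e] on a finType; [e] need not be
   irreflexive, so loops are allowed, and a loop counts once in [regular]. *)
Section Graph.
Variables (V : finType) (e : rel V).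

Definition regular (d : nat) := forall x : V, #|e x| = d.

Definition connected_graph := forall x y : V, connect e x y.

Definition graph_automorphism (f : {perm V}) :=
  forall x y : V, e (f x) (f y) = e x y.

Definition vertex_transitive :=
  forall x y : V, exists2 f : {perm V}, graph_automorphism f & f x = y.

Definition walk_of_length (n : nat) (x y : V) : bool :=
  [exists p : n.-tuple V, path e x p && (last x p == y)].

(* The least n such that [walk_of_length n x y]. A shortest path visits no
   vertex twice, so searching n < #|V| suffices; the value #|V| only occurs
   when y cannot be reached from x. *)
Definition gdist (x y : V) : nat :=
  find (fun n => walk_of_length n x y) (iota 0 #|V|).

End Graph.

(* The eigenvalues of A in R, with (algebraic) multiplicity, in nonincreasing
   order. When A is symmetric there are n of them. *)
Definition eigenvalues (R : rcfType) (n : nat) (A : 'M[R]_n) : seq R :=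
  sort (fun a b => b <= a)
    (flatten [seq nseq (mup a (char_poly A)) a
             | a <- polyrcf.rootsR (char_poly A)]).

(* Only meaningful if A has at least two eigenvalues. *)
Definition second_eigenvalue (R : rcfType) (n : nat) (A : 'M[R]_n) : R :=
  nth 0 (eigenvalues A) 1.

Section RandomWalk.
Variables (R : realType) (V : finType) (e : rel V) (d : nat).

Definition transition (x y : V) : R := (e x y)%:R / d%:R.

Definition transition_matrix : 'M[R]_#|V| :=
  \matrix_(i, j) transition (enum_val i) (enum_val j).

(* The law of X 0 is arbitrary. The second condition is
   P(X_{n+1} = y | X_0 = x_0, ..., X_n = x_n) = transition x_n y,
   multiplied out so that conditioning events of probability 0 are harmless. *)
Definition simple_random_walk (disp : measure_display)
    (Omega : measurableType disp) (P : probability Omega R)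
    (X : nat -> Omega -> V) : Prop :=
  (forall n x, measurable [set w | X n w = x]) /\
  (forall (n : nat) (x : nat -> V) (y : V),
     P [set w | (forall i, (i <= n)%N -> X i w = x i) /\ X n.+1 w = y] =
     (P [set w | forall i, (i <= n)%N -> X i w = x i]
        * (transition (x n) y)%:E)%E).

End RandomWalk.

(* Main.v *)
(* Let psi be an eigenfunction of P for lambda. Running psi over all translates
   by automorphisms gives a map Psi from V to a Euclidean space with
   P Psi = lambda Psi and, by transitivity, with |Psi| constant; normalize it so
   that an edge at any vertex has mean squared length 1. Each edge then has
   squared length at most d, so Psi is sqrt d-Lipschitz, and
   f(x, y) = |Psi(y) - Psi(x)|^2 satisfies P f(x, .) = 1 + lambda f(x, .).
   For t <= 1/(1 - lambda) this gives t/2 <= E f <= t, hence the first claim.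
   Since the increments have squared norm at most d <= t, also E f^2 = O(t^2),
   which gives the lower bound on the first moment.
   For small balls, the function sqrt(rho^2 + f) is convex along the walk, and
   grows by at least 1/(14 rho) per step on {f <= rho^2} when rho^2 >= d, up to
   a total drift O(sqrt t); its final mean is O(sqrt t), so the expected time
   spent in {f <= rho^2} is O(rho sqrt t).
   Radii below 1 only concern returns to the starting point. If u is the
   expected number of visits up to time T and M = u(x), then the Dirichlet
   energy of u is at most M, while u falls below M / 2 within distance
   O(T / (d M)) of x, as geodesics in regular graphs have many neighbours and
   the sum of u is T. Comparing along a geodesic gives M = O(sqrt T). If u never
   falls below M / 2, then M <= 2 T / |V|, and T = O(|V|^2) because the diameter
   is O(|V| / d). *)
Require Import Defs.
From HB Require Import structures.
From mathcomp Require Import all_boot all_order all_algebra fingroup perm.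
From mathcomp Require Import all_classical all_reals all_analysis measurable_realfun.
From mathcomp Require Import ring lra zify.

Set Implicit Arguments.
Unset Strict Implicit.
Unset Printing Implicit Defensive.

Import Order.TTheory GRing.Theory Num.Theory.
Local Open Scope classical_set_scope.
Local Open Scope ring_scope.

(** * Graph distance and edge energy *)

Section GraphDistance.
Variables (V : finType) (e : rel V).
Hypothesis econ : connected_graph e.

Lemma gdist_le_walk (n : nat) (x y : V) :
  walk_of_length e n x y -> (gdist e x y <= n)%N.
Proof.
move=> w; have [nV|Vn] := ltnP n #|V|; last first.
  by apply: leq_trans Vn; rewrite -[leqRHS](size_iota 0) find_size.
rewrite leqNgt; apply/negP => /(before_find 0%N).
by rewrite nth_iota// add0n w.
Qed.

(** By connectivity there is a path, and its repetition-free shortening has fewer than [#|V|] edges,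
    so the search defining [gdist] succeeds instead of returning its default. *)
Lemma walk_gdist (x y : V) : walk_of_length e (gdist e x y) x y.
Proof.
have hw : has (fun n => walk_of_length e n x y) (iota 0 #|V|).
  have /connectP[p0 + ->] := econ x y.
  case/shortenP => p pp up _; apply/hasP; exists (size p).
    rewrite mem_iota add0n /=; have := max_card [in x :: p].
    by rewrite (card_uniqP up).
  by apply/existsP; exists (in_tuple p); rewrite pp eqxx.
have := nth_find 0%N hw; rewrite nth_iota ?add0n//.
by move: hw; rewrite has_find size_iota.
Qed.

Lemma gdist_xx (x : V) : gdist e x x = 0%N.
Proof.
by apply/eqP; rewrite -leqn0; apply: gdist_le_walk; apply/existsP;
  exists [tuple]; rewrite /= eqxx.
Qed.

Lemma gdist_eq0 (x y : V) : (gdist e x y == 0%N) = (x == y).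
Proof.
apply/eqP/eqP => [d0|->]; last exact: gdist_xx.
have := walk_gdist x y; rewrite d0 => /existsP[p].
by rewrite tuple0 /= => /eqP.
Qed.

Lemma gdist_edge (x y z : V) : e y z -> (gdist e x z <= (gdist e x y).+1)%N.
Proof.
move=> yz; have /existsP[p /andP[pp /eqP ly]] := walk_gdist x y.
apply: gdist_le_walk; apply/existsP; exists (rcons_tuple p z).
by rewrite /= rcons_path pp ly yz last_rcons eqxx.
Qed.

Lemma gdist_pred (x y : V) (n : nat) : gdist e x y = n.+1 ->
  exists2 z, e z y & gdist e x z = n.
Proof.
move=> dn; have := walk_gdist x y; rewrite dn => /existsP[p].
case/tupleP: p => a q.
have -> : tval [tuple of a :: q] = rcons (belast a q) (last a q).
  by rewrite -lastI.
rewrite rcons_path last_rcons => /andP[/andP[pp lz] /eqP ey].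
have ly := lz; rewrite ey in ly.
exists (last x (belast a q)) => //.
apply/eqP; rewrite eqn_leq; apply/andP; split.
  apply: gdist_le_walk; apply/existsP.
  have sz : size (belast a q) == n by rewrite size_belast size_tuple.
  by exists (Tuple sz); rewrite /= pp eqxx.
by rewrite -ltnS -dn; apply: gdist_edge.
Qed.

Definition geodesic (x y : V) (g : nat -> V) (r : nat) : Prop :=
  [/\ g r = y, (forall j, (j <= r)%N -> gdist e x (g j) = j)
    & (forall j, (j < r)%N -> e (g j) (g j.+1))].

Lemma geodesic_exists (x y : V) : exists g, geodesic x y g (gdist e x y).
Proof.
have [r dr] : exists r, gdist e x y = r by exists (gdist e x y).
rewrite dr; elim: r => [|r IH] in y dr *.
  exists (fun=> x); move/eqP: dr; rewrite gdist_eq0 => /eqP <-.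
  by split => // j; rewrite leqn0 => /eqP ->; rewrite gdist_xx.
have [z zy dz] := gdist_pred dr; have [g [gr gd ge]] := IH z dz.
exists (fun j => if (j <= r)%N then g j else y); split; first by rewrite ltnn.
  move=> j; rewrite leq_eqVlt => /predU1P[->|]; first by rewrite ltnn.
  by rewrite ltnS => jr; rewrite jr gd.
move=> j; rewrite ltnS => jr; rewrite jr.
have [jr'|rj] := ltnP j r; first exact: ge.
have -> : j = r by lia.
by rewrite gr.
Qed.

Lemma geodesic0 (x y : V) g r : geodesic x y g r -> g 0%N = x.
Proof. by case=> _ gd _; apply/esym/eqP; rewrite -gdist_eq0 gd. Qed.

Lemma neighbor_exists (x : V) : (1 < #|V|)%N -> exists2 z, e x z & x != z.
Proof.
move=> V2; have [y yx] : exists y, x != y.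
  apply/existsP; rewrite -[[exists _, _]]negbK negb_exists.
  apply: contraTN V2 => /forallP h; rewrite -leqNgt -(card1 x).
  apply: subset_leq_card; apply/fintype.subsetP => y _.
  by have := h y; rewrite negbK inE eq_sym.
have [g gg] := geodesic_exists x y; have g0 := geodesic0 gg.
have r0 : (0 < gdist e x y)%N by rewrite lt0n gdist_eq0.
case: gg => _ gd ge; exists (g 1%N); first by rewrite -{1}g0 ge.
by rewrite -gdist_eq0 gd.
Qed.

Hypothesis esym : symmetric e.
Variable d : nat.
Hypothesis ereg : regular e d.

(* A vertex is adjacent to at most three vertices of a geodesic. *)
Lemma geodesic_neighbors (x y : V) g r m (S : pred V) : geodesic x y g r ->
  (m <= r.+1)%N -> (forall j z, (j < m)%N -> e (g j) z -> S z) ->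
  (d * m <= 3 * #|S|)%N.
Proof.
move=> [_ gd _] mr gS.
(* Double counting of the adjacent pairs formed by one of the first [m] vertices of the geodesic and
   a vertex of [S]. *)
have -> : (d * m = \sum_(j < m) \sum_(z | S z) e (g j) z)%N.
  rewrite mulnC -[m in LHS]card_ord -sum_nat_const; apply: eq_bigr => j _.
  rewrite -(ereg (g j)) -sum1_card big_mkcond/= [RHS]big_mkcond/=.
  apply: eq_bigr => z _; have -> : (z \in e (g j)) = e (g j) z by [].
  case ez: (e (g j) z); last by rewrite if_same.
  by rewrite (gS j z (ltn_ord j) ez).
rewrite exchange_big/= mulnC -sum_nat_const; apply: leq_sum => z _.
pose k := gdist e x z.
(* Adjacency forces [j] and [k] to differ by at most 1; for [k = 0] the truncated [k.-1] merely
   repeats [k]. *)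
have near (j : 'I_m) : e (g j) z -> [|| j == k.-1 :> nat, j == k :> nat | j == k.+1 :> nat].
  move=> jz; have jr : (j <= r)%N by have := ltn_ord j; lia.
  have := gdist_edge x jz; rewrite (gd _ jr) -/k.
  by have := gdist_edge x (etrans (esym _ _) jz); rewrite (gd _ jr) -/k; lia.
have one (i : nat) : (\sum_(j < m) (j == i :> nat) <= 1)%N.
  rewrite -big_mkcond/= sum1_card; apply/card_le1_eqP => a b.
  by move=> /eqP ea /eqP eb; apply: val_inj; rewrite /= ea eb.
have := leq_add (leq_add (one k.-1) (one k)) (one k.+1).
apply: leq_trans; rewrite -!big_split/=; apply: leq_sum => j _.
by case ez: (e (g j) z) => //; have := near j ez; lia.
Qed.

End GraphDistance.

(** Cauchy-Schwarz for a telescoping sum; the induction step, multiplied by [m], comes down to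
    [0 <= (p - m * q) ^+ 2]. *)
Lemma sqr_telescope_le (R : realFieldType) (a : nat -> R) (n : nat) :
  (a 0%N - a n) ^+ 2 <= n%:R * \sum_(j < n) (a j - a j.+1) ^+ 2.
Proof.
elim: n => [|n IH]; first by rewrite subrr expr0n/= mul0r.
rewrite big_ord_recr/=; set s := \sum_(j < n) _ in IH *.
have [n0|n0] := posnP n.
  by rewrite /s n0 big_ord0 add0r mul1r.
have np : (0 : R) < n%:R by rewrite ltr0n.
set p := a 0%N - a n in IH *; set q := a n - a n.+1.
have -> : a 0%N - a n.+1 = p + q by rewrite /p /q; ring.
rewrite -natr1; set m := n%:R in IH np *.
rewrite -(ler_pM2l np).
have : 0 <= (p - m * q) ^+ 2 by exact: sqr_ge0.
nra.
Qed.

Section EdgeEnergy.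
Variables (R : realFieldType) (V : finType) (e : rel V).
Hypothesis econ : connected_graph e.

(** The Dirichlet energy over ordered pairs: an edge between distinct vertices counts twice, a loop
    contributes 0. *)
Definition edge_energy (u : V -> R) : R :=
  \sum_y \sum_z (e y z)%:R * (u y - u z) ^+ 2.

(** Cauchy-Schwarz along a geodesic, whose edges are told apart by the distance of their first
    endpoint from [x] and so enter the energy as distinct terms. *)
Lemma sqr_diff_le_energy (u : V -> R) (x y : V) :
  (u x - u y) ^+ 2 <= (gdist e x y)%:R * edge_energy u.
Proof.
have [g gg] := geodesic_exists econ x y; set r := gdist e x y in gg *.
have g0 := geodesic0 econ gg; case: gg => gr gd ge.
rewrite -g0 -gr; apply: le_trans (sqr_telescope_le (fun j => u (g j)) r) _.
apply: ler_wpM2l; first exact: ler0n.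
rewrite /edge_energy pair_big/=.
pose h (j : 'I_r) := (g j, g j.+1).
have hinj : injective h.
  move=> i j [/(congr1 (gdist e x))]; rewrite !gd ?(ltnW (ltn_ord _))// => ij _.
  exact: val_inj.
rewrite (bigID (fun p => p \in [set h j | j : 'I_r]%SET))/=.
rewrite big_imset/=; last by move=> ? ? _ _; apply: hinj.
have -> : \sum_(j in 'I_r) (e (g j) (g j.+1))%:R * (u (g j) - u (g j.+1)) ^+ 2
   = \sum_(j < r) (u (g j) - u (g j.+1)) ^+ 2.
  by apply: eq_big => // j _; rewrite ge// mul1r.
rewrite lerDl; apply: sumr_ge0 => p _.
by rewrite mulr_ge0 ?ler0n ?sqr_ge0.
Qed.

End EdgeEnergy.

(** * Expected number of returns *)

Section Returns.
Variables (R : realType) (V : finType) (e : rel V) (d : nat).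
Hypothesis (esym : symmetric e) (econ : connected_graph e) (ereg : regular e d).
Hypothesis d_gt0 : (0 < d)%N.
Local Notation p := (transition R e d).

Let dR_gt0 : (0 : R) < d%:R. Proof. by rewrite ltr0n. Qed.

Lemma transition_ge0 (y z : V) : 0 <= p y z.
Proof. by rewrite /transition divr_ge0 ?ler0n. Qed.

Lemma transition_sym (y z : V) : p y z = p z y.
Proof. by rewrite /transition esym. Qed.

Lemma sum_edges (y : V) : \sum_z (e y z)%:R = d%:R :> R.
Proof.
by rewrite -natr_sum -(ereg y) -sum1_card [in RHS]big_mkcond.
Qed.

Lemma transition_sum (y : V) : \sum_z p y z = 1.
Proof. by rewrite -mulr_suml sum_edges divff// gt_eqF. Qed.

(** Summation by parts: expand the square and use that [p] is symmetric with row sums 1. *)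
Lemma edge_energy_transition (u : V -> R) :
  edge_energy e u = 2 * d%:R * \sum_y u y * (u y - \sum_z p y z * u z).
Proof.
have -> : edge_energy e u = d%:R * \sum_y \sum_z p y z * (u y - u z) ^+ 2.
  rewrite mulr_sumr; apply: eq_bigr => y _; rewrite mulr_sumr.
  by apply: eq_bigr => z _; rewrite /transition; field; exact: lt0r_neq0.
rewrite [2 * _]mulrC -mulrA; congr (_ * _).
have -> : \sum_y \sum_z p y z * (u y - u z) ^+ 2 =
    \sum_y \sum_z p y z * (u y ^+ 2) + \sum_y \sum_z p y z * (u z ^+ 2)
    - 2 * \sum_y \sum_z p y z * u y * u z.
  rewrite mulr_sumr -big_split/= -sumrB; apply: eq_bigr => y _.
  by rewrite mulr_sumr -big_split/= -sumrB; apply: eq_bigr => z _; ring.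
have -> : \sum_y \sum_z p y z * (u z ^+ 2) = \sum_y \sum_z p y z * (u y ^+ 2).
  rewrite exchange_big/=; apply: eq_bigr => y _; apply: eq_bigr => z _.
  by rewrite transition_sym.
have -> : \sum_y \sum_z p y z * (u y ^+ 2) = \sum_y u y ^+ 2.
  by apply: eq_bigr => y _; rewrite -mulr_suml transition_sum mul1r.
have -> : \sum_y \sum_z p y z * u y * u z = \sum_y u y * \sum_z p y z * u z.
  by apply: eq_bigr => y _; rewrite mulr_sumr; apply: eq_bigr => z _; ring.
rewrite [in RHS](eq_bigr (fun y => u y ^+ 2 - u y * \sum_z p y z * u z)).
  by rewrite sumrB; ring.
by move=> y _; rewrite mulrBr expr2.
Qed.

(** The law at time [s] of the walk started at [x], by the forward recursion. *)
Fixpoint heat (x : V) (s : nat) (y : V) : R :=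
  if s is s'.+1 then \sum_z heat x s' z * p z y else (y == x)%:R.

Lemma heat_ge0 (x : V) s y : 0 <= heat x s y.
Proof.
elim: s y => [|s IH] y /=; first exact: ler0n.
by apply: sumr_ge0 => z _; rewrite mulr_ge0 ?transition_ge0.
Qed.

Lemma heat_sum (x : V) s : \sum_y heat x s y = 1.
Proof.
elim: s => [|s IH] /=.
  rewrite (bigD1 x)//= eqxx big1 ?addr0// => y /negbTE -> //.
rewrite exchange_big/= -IH; apply: eq_bigr => z _.
by rewrite -mulr_sumr transition_sum mulr1.
Qed.

(** The expected number of visits to [y] at times 0 to [T - 1], starting from [x]. *)
Definition green (x : V) (T : nat) (y : V) : R := \sum_(s < T) heat x s y.

Lemma green_ge0 (x : V) T y : 0 <= green x T y.
Proof. by apply: sumr_ge0 => s _; apply: heat_ge0. Qed.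

Lemma green_sum (x : V) T : \sum_y green x T y = T%:R.
Proof.
rewrite exchange_big/= (eq_bigr (fun=> 1)); last by move=> s _; exact: heat_sum.
by rewrite sumr_const card_ord.
Qed.

(** Applying [p] turns [heat x s] into [heat x s.+1], so the difference telescopes. *)
Lemma green_laplacian (x : V) T y :
  green x T y - \sum_z p y z * green x T z = heat x 0 y - heat x T y.
Proof.
have -> : \sum_z p y z * green x T z = \sum_(s < T) heat x s.+1 y.
  rewrite (eq_bigr (fun z => \sum_(s < T) p y z * heat x s z)); last first.
    by move=> z _; rewrite mulr_sumr.
  rewrite exchange_big/=; apply: eq_bigr => s _; apply: eq_bigr => z _.
  by rewrite mulrC transition_sym.
rewrite /green; elim: T => [|T IH]; first by rewrite !big_ord0 !subrr.
by rewrite !big_ord_recr/= -/(heat x T.+1 y) opprD addrACA IH addrA subrK.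
Qed.

(** After summation by parts, the source [heat x 0] charges only [x], and [heat x T] enters with a
    negative sign. *)
Lemma green_energy (x : V) T :
  edge_energy e (green x T) <= 2 * d%:R * green x T x.
Proof.
rewrite edge_energy_transition ler_pM2l ?mulr_gt0//.
under eq_bigr do rewrite green_laplacian mulrBr.
rewrite sumrB [X in X - _](bigD1 x)//= eqxx mulr1 big1 ?addr0.
  rewrite gerBl; apply: sumr_ge0 => y _.
  by rewrite mulr_ge0 ?green_ge0 ?heat_ge0.
by move=> y /negbTE ->; rewrite mulr0.
Qed.

Lemma green_level_card (x : V) T (a : R) :
  #|[pred y | a <= green x T y]|%:R * a <= T%:R.
Proof.
rewrite -(green_sum x T) mulr_natl -sumr_const big_mkcond/=.
apply: ler_sum => y _; rewrite inE; case: ifP => // _; exact: green_ge0.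
Qed.

Lemma green_diag_le (x : V) (T : nat) : (0 < T)%N -> (T <= 18 * #|V| ^ 2)%N ->
  green x T x ^+ 2 <= 96 * T%:R.
Proof.
move=> T0 Tn; set M := green x T x; set u := green x T.
have T1 : (1 : R) <= T%:R by rewrite ler1n.
have M0 : 0 < M.
  rewrite /M /green -(prednK T0) big_ord_recl.
  apply: ltr_pwDl; first by rewrite /= eqxx.
  by apply: sumr_ge0 => s _; exact: heat_ge0.
have MT : M <= T%:R.
  rewrite -(green_sum x T) (bigD1 x)//= lerDl; apply: sumr_ge0 => y _.
  exact: green_ge0.
pose S := [pred y | M / 2 <= u y].
have cS : #|S|%:R * (M / 2) <= T%:R by exact: green_level_card.
(* If [S] is everything, then [#|V| * M <= 2 * T]; squaring and using [T <= 18 * #|V| ^ 2] gives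
   [M ^+ 2 <= 72 * T]. *)
have [/existsP[z0 z0S]|/existsPn allS] := boolP [exists z, z \notin S]; last first.
  have eS : #|S| = #|V| by apply: eq_card => y; have := allS y; rewrite negbK.
  rewrite eS in cS.
  have TnR : T%:R <= 18 * #|V|%:R ^+ 2 :> R by rewrite -natrX -natrM ler_nat.
  have n0 : 0 <= #|V|%:R :> R by [].
  set n := #|V|%:R in cS TnR n0; set t := T%:R in cS TnR T1 MT *.
  have nM : (n * (M / 2)) ^+ 2 <= t ^+ 2.
    by rewrite ler_pXn2r// nnegrE ?mulr_ge0//; lra.
  have t0 : 0 < t by lra.
  rewrite -(ler_pM2r t0).
  have : M ^+ 2 * t <= M ^+ 2 * (18 * n ^+ 2) by rewrite ler_wpM2l ?sqr_ge0.
  have : 0 <= t ^+ 2 by exact: sqr_ge0.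
  lra.
(* A vertex outside [S] nearest to [x]: all vertices at distance less than [r] lie in [S]. *)
have [z zS zmin] := @arg_minnP _ z0 [pred y | y \notin S] (gdist e x) z0S.
set r := gdist e x z in zmin.
have uz : u z < M / 2 by rewrite ltNge.
have ux : u x = M by [].
have inS y : (gdist e x y < r)%N -> y \in S.
  by move=> yr; apply: contraLR yr => /zmin; rewrite -leqNgt.
have xS : x \in S by rewrite inE ux; lra.
have r0 : (0 < r)%N.
  by rewrite lt0n gdist_eq0//; apply: contraNneq zS => <-.
have := sqr_diff_le_energy econ u x z.
rewrite -/r => hp.
(* The drop by at least [M / 2] between [x] and [z], against the energy bound, amounts to
   [M <= 8 * r * d]. *)
have {}hp : (M / 2) ^+ 2 <= r%:R * (2 * d%:R * M).
  apply: le_trans (le_trans hp _); last first.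
    by rewrite ler_wpM2l//; exact: green_energy.
  by rewrite ler_pXn2r ?nnegrE//; lra.
(* For [r = 1] counting neighbours along the geodesic gives nothing, as its factor [r - 1] is 0. *)
have [r1|r1] := leqP r 1.
  have {}r1 : r = 1%N by apply/eqP; rewrite eqn_leq r1.
  rewrite r1 mul1r in hp.
  (* The neighbours of x split into those in S, few because of [cS], and
     those outside S, each of which costs energy [(M / 2) ^+ 2]. *)
  pose a := #|[pred y | e x y && (y \in S)]|.
  pose b := #|[pred y | e x y && (y \notin S)]|.
  have ab : (a + b = d)%N.
    rewrite -(ereg x) -(cardID S (e x)) /a /b; congr addn; apply: eq_card => y //.
    exact: andbC.
  have aS : (a <= #|S|)%N by apply: subset_leq_card; apply/fintype.subsetP => y /andP[].
  have hb : b%:R * (M / 2) ^+ 2 <= 2 * d%:R * M.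
    apply: le_trans (green_energy x T); rewrite /edge_energy (bigD1 x)//=.
    apply: ler_wpDr.
      by do 2 (apply: sumr_ge0 => ? _); rewrite mulr_ge0// sqr_ge0.
    rewrite mulr_natl -sumr_const big_mkcond/=; apply: ler_sum => y _.
    case: ifP => [/andP[exy yS]|_]; last by rewrite mulr_ge0// sqr_ge0.
    rewrite exy mul1r -/u ux; have uy : u y < M / 2 by rewrite ltNge.
    by rewrite ler_pXn2r ?nnegrE//; lra.
  have abR : a%:R + b%:R = d%:R :> R by rewrite -natrD ab.
  have aSR : a%:R <= #|S|%:R :> R by rewrite ler_nat.
  have [a0 b0] : 0 <= a%:R :> R /\ 0 <= b%:R :> R by [].
  set A := a%:R in abR aSR a0; set B := b%:R in hb abR b0.
  set D := d%:R in hp hb abR *; set t := T%:R in T1 MT cS *.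
  have aM : A * (M / 2) <= t by apply: le_trans cS; rewrite ler_wpM2r//; lra.
  have M8 : M <= 8 * D by rewrite -(ler_pM2r M0); lra.
  have bM : B * M <= 8 * D by rewrite -(ler_pM2r M0); lra.
  (* For [M <= 16] the bound [M <= T] suffices; otherwise at least half of the neighbours of [x] lie
     in [S], so [d * M <= 4 * T], to be combined with [M <= 8 * d]. *)
  have [M16|M16] := leP M 16.
    have : M * M <= 16 * M by rewrite ler_pM2r.
    lra.
  have B2 : 2 * B <= D by have := ler_wpM2l b0 (ltW M16); lra.
  have DA : D <= 2 * A by lra.
  have : D * M <= 2 * A * M by rewrite ler_pM2r.
  have : M * M <= 8 * D * M by rewrite ler_pM2r.
  lra.
have [g gg] := geodesic_exists econ x z.
(* The first [r - 1] vertices of the geodesic have all their neighbours in [S]. As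
   [r <= 2 * (r - 1)], this gives [M <= 48 * #|S|], and [#|S| * M <= 2 * T] yields the constant
   96. *)
have hd : (d * r.-1 <= 3 * #|S|)%N.
  apply: (geodesic_neighbors econ esym ereg gg).
    exact: leq_trans (leq_pred _) (leqnSn _).
  move=> j y jr gjy; apply: inS; case: gg => _ gd _.
  have jr1 : (j.+1 < r)%N by rewrite -(prednK r0) ltnS.
  apply: leq_ltn_trans (gdist_edge econ x gjy) _.
  by rewrite gd// ltnW// ltnW.
have hdR : d%:R * (r%:R - 1) <= 3 * #|S|%:R :> R.
  have -> : r%:R - 1 = r.-1%:R :> R by rewrite -subn1 natrB.
  by rewrite -!natrM ler_nat.
have r2 : 2 <= r%:R :> R by rewrite ler_nat.
set rr := r%:R in hp hdR r2; set s := #|S|%:R in cS hdR.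
have D0 := dR_gt0; set D := d%:R in hp hdR D0.
set t := T%:R in cS T1 MT *.
have k1 : M <= 8 * (rr * D) by rewrite -(ler_pM2r M0); lra.
have k2 : rr * D <= 6 * s by have := ler_wpM2l (ltW D0) r2; lra.
have : M * M <= 48 * s * M by rewrite ler_pM2r//; lra.
lra.
Qed.

End Returns.

(** * Equivariant Euclidean embeddings *)

Lemma sum_Cauchy_Schwarz (R : realFieldType) (I : finType) (a b : I -> R) :
  (\sum_i a i * b i) ^+ 2 <= (\sum_i a i ^+ 2) * (\sum_i b i ^+ 2).
Proof.
set A := \sum_i a i ^+ 2; set B := \sum_i b i ^+ 2; set C := \sum_i a i * b i.
have B0 : 0 <= B by apply: sumr_ge0 => i _; exact: sqr_ge0.
have : 0 <= \sum_i (B * a i - C * b i) ^+ 2.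
  by apply: sumr_ge0 => i _; exact: sqr_ge0.
have -> : \sum_i (B * a i - C * b i) ^+ 2 = B * (A * B - C ^+ 2).
  transitivity (B ^+ 2 * A - 2 * B * C * C + C ^+ 2 * B); last by ring.
  have -> : B ^+ 2 * A = \sum_i B ^+ 2 * a i ^+ 2 by rewrite mulr_sumr.
  have -> : 2 * B * C * C = \sum_i 2 * B * C * (a i * b i) by rewrite mulr_sumr.
  have -> : C ^+ 2 * B = \sum_i C ^+ 2 * b i ^+ 2 by rewrite mulr_sumr.
  by rewrite -sumrB -big_split/=; apply: eq_bigr => i _; ring.
have [Bp|] := ltP 0 B; first by rewrite pmulr_rge0// subr_ge0.
move=> Bn _; have {Bn B0} B0 : B = 0 by apply: le_anti; rewrite Bn B0.
rewrite B0 mulr0 /C big1 ?expr0n// => i _.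
have /psumr_eq0P : forall i : I, true -> 0 <= b i ^+ 2 by move=> *; exact: sqr_ge0.
by move=> /(_ B0 i isT)/eqP; rewrite sqrf_eq0 => /eqP ->; rewrite mulr0.
Qed.

(** * Quantitative convexity of sqrt(rho^2 + |m|^2) *)

Section Huber.
Variable R : rcfType.

(* The convexity of [m |-> sqrt (rho^2 + |m|^2)] on a Euclidean space, at [m]
   and [m + D], in terms of f = |m|^2, w = <m, D> and delta = |D|^2. *)
Lemma huber_convex (f w delta rho : R) :
  0 < rho -> 0 <= f -> 0 <= delta -> 0 <= f + 2 * w + delta ->
  w ^+ 2 <= f * delta ->
  Num.sqrt (rho ^+ 2 + f) + w / Num.sqrt (rho ^+ 2 + f) <=
  Num.sqrt (rho ^+ 2 + (f + 2 * w + delta)).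
Proof.
move=> r0 f0 d0 f'0 wf; have r20 : 0 < rho ^+ 2 by rewrite exprn_gt0.
have Hs : Num.sqrt (rho ^+ 2 + f) ^+ 2 = rho ^+ 2 + f by rewrite sqr_sqrtr; lra.
have Ks : Num.sqrt (rho ^+ 2 + (f + 2 * w + delta)) ^+ 2 =
  rho ^+ 2 + (f + 2 * w + delta) by rewrite sqr_sqrtr; lra.
have H0 : 0 < Num.sqrt (rho ^+ 2 + f) by rewrite sqrtr_gt0; lra.
have K0 := sqrtr_ge0 (rho ^+ 2 + (f + 2 * w + delta)).
set H := Num.sqrt (rho ^+ 2 + f) in Hs H0 *.
set K := Num.sqrt _ in Ks K0 *.
rewrite -(ler_pM2r H0) mulrDl divfK ?gt_eqF// -expr2.
have s0 : 0 <= K * H by rewrite mulr_ge0// ltW.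
have q2 : (H ^+ 2 + w) ^+ 2 <= (K * H) ^+ 2.
  rewrite exprMn Ks Hs.
  have : 0 <= rho ^+ 2 * delta by rewrite mulr_ge0// ltW.
  lra.
rewrite leNgt; apply/negP => lt.
suff : (K * H) ^+ 2 < (H ^+ 2 + w) ^+ 2 by rewrite ltNge q2.
by rewrite ltr_pXn2r ?nnegrE//; lra.
Qed.

(** With [H], [K] the two square roots, [(K * H) ^+ 2 - (H ^+ 2 + w) ^+ 2] is at least
    [rho ^+ 2 * delta]. The factor [K * H + (H ^+ 2 + w)] is at most [(4 + 2 + 1) * rho ^+ 2], and
    dividing by [H <= 2 * rho] gives 14. *)
Lemma huber_strongly_convex (f w delta rho : R) :
  0 < rho -> 0 <= f -> 0 <= delta -> 0 <= f + 2 * w + delta ->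
  w ^+ 2 <= f * delta -> f <= rho ^+ 2 -> delta <= rho ^+ 2 ->
  Num.sqrt (rho ^+ 2 + f) + w / Num.sqrt (rho ^+ 2 + f) + delta / (14 * rho) <=
  Num.sqrt (rho ^+ 2 + (f + 2 * w + delta)).
Proof.
move=> r0 f0 d0 f'0 wf fr dr; have r20 : 0 < rho ^+ 2 by rewrite exprn_gt0.
have cvx := huber_convex r0 f0 d0 f'0 wf.
have Hs : Num.sqrt (rho ^+ 2 + f) ^+ 2 = rho ^+ 2 + f by rewrite sqr_sqrtr; lra.
have Ks : Num.sqrt (rho ^+ 2 + (f + 2 * w + delta)) ^+ 2 =
  rho ^+ 2 + (f + 2 * w + delta) by rewrite sqr_sqrtr; lra.
have H0 : 0 < Num.sqrt (rho ^+ 2 + f) by rewrite sqrtr_gt0; lra.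
have K0 := sqrtr_ge0 (rho ^+ 2 + (f + 2 * w + delta)).
set H := Num.sqrt (rho ^+ 2 + f) in Hs H0 cvx *.
set K := Num.sqrt _ in Ks K0 cvx *.
have qs : H ^+ 2 + w <= K * H.
  by move: cvx; rewrite -(ler_pM2r H0) mulrDl divfK ?gt_eqF// -expr2.
have s0 : 0 <= K * H by rewrite mulr_ge0// ltW.
have w1 : w <= rho ^+ 2.
  rewrite leNgt; apply/negP => lt.
  have : (rho ^+ 2) ^+ 2 < w ^+ 2 by rewrite ltr_pXn2r ?nnegrE//; lra.
  have : f * delta <= rho ^+ 2 * rho ^+ 2 by rewrite ler_pM.
  lra.
have s1 : K * H <= 4 * rho ^+ 2.
  rewrite -(@ler_pXn2r _ 2)// ?nnegrE; [|lra].
  rewrite exprMn Ks Hs exprMn.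
  have : (rho ^+ 2 + (f + 2 * w + delta)) * (rho ^+ 2 + f) <=
         (5 * rho ^+ 2) * (2 * rho ^+ 2) by rewrite ler_pM//; lra.
  have : 0 <= (rho ^+ 2) ^+ 2 by exact: sqr_ge0.
  lra.
have sq : rho ^+ 2 * delta <= (K * H - (H ^+ 2 + w)) * (K * H + (H ^+ 2 + w)).
  have -> : (K * H - (H ^+ 2 + w)) * (K * H + (H ^+ 2 + w)) =
    K ^+ 2 * H ^+ 2 - (H ^+ 2 + w) ^+ 2 by ring.
  rewrite Ks Hs; lra.
have sq7 : (K * H - (H ^+ 2 + w)) * (K * H + (H ^+ 2 + w)) <=
   (K * H - (H ^+ 2 + w)) * (7 * rho ^+ 2) by rewrite ler_wpM2l//; lra.
have d7 : delta <= 7 * (K * H - (H ^+ 2 + w)).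
  by rewrite -(ler_pM2l r20); lra.
have H2 : H <= 2 * rho.
  rewrite -(@ler_pXn2r _ 2)// ?nnegrE; [|lra|lra].
  by rewrite exprMn Hs; lra.
rewrite -(ler_pM2r H0) mulrDl [X in X + _]mulrDl divfK ?gt_eqF// -expr2.
have : delta / (14 * rho) * H <= delta / (14 * rho) * (2 * rho).
  by rewrite ler_wpM2l// divr_ge0//; lra.
have -> : delta / (14 * rho) * (2 * rho) = delta / 7.
  by field; rewrite gt_eqF.
lra.
Qed.

End Huber.

Section Embedding.
Variables (R : realType) (V : finType) (e : rel V) (d : nat).
Hypothesis (esym : symmetric e) (econ : connected_graph e) (ereg : regular e d).
Hypothesis d_gt0 : (0 < d)%N.
Local Notation p := (transition R e d).
Variables (I : finType) (Psi : I -> V -> R) (lam : R).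
Hypothesis lam_lt1 : lam < 1.
Hypothesis Psi_eigen : forall i y, \sum_z p y z * Psi i z = lam * Psi i y.
Hypothesis Psi_norm : forall y, \sum_i Psi i y ^+ 2 = (2 * (1 - lam))^-1.

Let lam_neq1 : 1 - lam != 0. Proof. by rewrite gt_eqF// subr_gt0. Qed.

Definition emb_sqdist (x y : V) : R := \sum_i (Psi i y - Psi i x) ^+ 2.
Definition emb_dot (x y z : V) : R :=
  \sum_i (Psi i y - Psi i x) * (Psi i z - Psi i y).
Local Notation f := emb_sqdist.
Local Notation w := emb_dot.

Lemma emb_sqdist_ge0 x y : 0 <= f x y.
Proof. by apply: sumr_ge0 => i _; exact: sqr_ge0. Qed.

Lemma emb_sqdist_xx x : f x x = 0.
Proof. by rewrite /f big1// => i _; rewrite subrr expr0n. Qed.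

Lemma emb_sqdist_add x y z : f x z = f x y + 2 * w x y z + f y z.
Proof. by rewrite /f /w mulr_sumr -!big_split/=; apply: eq_bigr => i _; ring. Qed.

Lemma emb_dot_le x y z : w x y z ^+ 2 <= f x y * f y z.
Proof. exact: sum_Cauchy_Schwarz. Qed.

Lemma emb_sqdistE x y : f x y = (1 - lam)^-1 - 2 * \sum_i Psi i x * Psi i y.
Proof.
have -> : (1 - lam)^-1 = (2 * (1 - lam))^-1 + (2 * (1 - lam))^-1.
  by field.
rewrite -{1}(Psi_norm x) -(Psi_norm y) mulr_sumr -big_split -sumrB/=.
by apply: eq_bigr => i _; ring.
Qed.

(** The value in [Psi_norm] is chosen to make this mean 1. *)
Lemma mean_emb_sqdist y : \sum_z p y z * f y z = 1.
Proof.
under eq_bigr do rewrite emb_sqdistE mulrBr.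
rewrite sumrB -mulr_suml (transition_sum R ereg d_gt0) mul1r.
have -> : \sum_z p y z * (2 * \sum_i Psi i y * Psi i z) =
    2 * (lam * \sum_i Psi i y ^+ 2).
  under eq_bigr do rewrite !mulr_sumr.
  rewrite exchange_big/= !mulr_sumr; apply: eq_bigr => i _.
  transitivity (2 * Psi i y * \sum_z p y z * Psi i z).
    by rewrite mulr_sumr; apply: eq_bigr => z _; ring.
  by rewrite Psi_eigen; ring.
by rewrite Psi_norm; field.
Qed.

(** The mean step from [y] is [(lam - 1)] times the position vector of [y], whose inner product with
    the displacement from [x] is [f x y / 2] because all norms agree. *)
Lemma mean_emb_dot x y : \sum_z p y z * w x y z = - ((1 - lam) / 2 * f x y).
Proof.
have -> : \sum_z p y z * w x y z =
    \sum_i (Psi i y - Psi i x) * (lam * Psi i y - Psi i y).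
  under eq_bigr do rewrite mulr_sumr.
  rewrite exchange_big/=; apply: eq_bigr => i _.
  rewrite -Psi_eigen.
  have e1 : Psi i y = \sum_z p y z * Psi i y.
    by rewrite -mulr_suml (transition_sum R ereg d_gt0) mul1r.
  rewrite [X in _ = _ * (_ - X)]e1 -sumrB mulr_sumr.
  by apply: eq_bigr => z _; ring.
have -> : f x y = \sum_i (Psi i y - Psi i x) ^+ 2 + \sum_i Psi i y ^+ 2
   - \sum_i Psi i x ^+ 2 by rewrite !Psi_norm addrK.
rewrite -big_split -sumrB/= mulr_sumr -sumrN.
by apply: eq_bigr => i _; field.
Qed.

(** The one-step estimates below all reduce to averaging such a combination. *)
Lemma mean_affine x y (a b c : R) :
  \sum_z p y z * (a + b * w x y z + c * f y z) =
  a - b * ((1 - lam) / 2 * f x y) + c.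
Proof.
transitivity (a * (\sum_z p y z) + b * (\sum_z p y z * w x y z)
  + c * \sum_z p y z * f y z).
  by rewrite !mulr_sumr -!big_split/=; apply: eq_bigr => z _; ring.
by rewrite (transition_sum R ereg d_gt0) mean_emb_dot mean_emb_sqdist; ring.
Qed.

Lemma emb_sqdist_mean x y : \sum_z p y z * f x z = 1 + lam * f x y.
Proof.
under eq_bigr do rewrite (emb_sqdist_add x y) -[f y _]mul1r.
by rewrite mean_affine; field.
Qed.

Lemma emb_sqdist_edge y z : e y z -> f y z <= d%:R.
Proof.
move=> yz; have d0 : (0 : R) < d%:R by rewrite ltr0n.
have := congr1 ( *%R d%:R) (mean_emb_sqdist y); rewrite mulr1 => <-.
rewrite (bigD1 z)//= mulrDr.
have -> : d%:R * (p y z * f y z) = f y z.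
  by rewrite /transition yz mulr1n; field; exact: lt0r_neq0.
rewrite lerDl; apply: mulr_ge0; first exact: ltW.
apply: sumr_ge0 => u _.
by rewrite mulr_ge0 ?emb_sqdist_ge0// transition_ge0.
Qed.

Lemma emb_sqdist_le_gdist x y : f x y <= d%:R * (gdist e x y)%:R ^+ 2.
Proof.
have [g gg] := geodesic_exists econ x y; set r := gdist e x y in gg *.
have g0 := geodesic0 econ gg; case: gg => gr gd ge.
have -> : d%:R * r%:R ^+ 2 = r%:R * (\sum_(j < r) d%:R) :> R.
  by rewrite sumr_const card_ord -[_ *+ r]mulr_natr; ring.
apply: (@le_trans _ _ (r%:R * (\sum_(j < r) f (g j.+1) (g j)))); last first.
  rewrite ler_wpM2l// ler_sum// => j _.
  by apply: emb_sqdist_edge; rewrite esym ge.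
rewrite /f exchange_big/= mulr_sumr; apply: ler_sum => i _.
rewrite -{1}gr -{1}g0 -sqrrN opprB.
exact: (sqr_telescope_le (fun j => Psi i (g j)) r).
Qed.

Lemma emb_sqdist_sqr_mean x y :
  \sum_z p y z * f x z ^+ 2 <= f x y ^+ 2 + 10 * f x y + 2 * d%:R.
Proof.
have f0 := emb_sqdist_ge0 x y.
(* In the square of [F + 2 * W + D], the term [4 * F * W] is kept, since its mean is nonpositive;
   the rest is bounded using [W ^+ 2 <= F * D], [D <= d] and [4 * W * D <= 4 * W ^+ 2 + D ^+ 2]. *)
apply: (@le_trans _ _ (\sum_z p y z * (f x y ^+ 2 + (4 * f x y) * w x y z
    + (10 * f x y + 2 * d%:R) * f y z))); last first.
  rewrite mean_affine.
  have : 0 <= 4 * f x y * ((1 - lam) / 2 * f x y).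
    apply: mulr_ge0; first exact: mulr_ge0.
    by apply: mulr_ge0 => //; rewrite divr_ge0// subr_ge0 ltW.
  lra.
apply: ler_sum => z _; have [yz|yz] := boolP (e y z); last first.
  by rewrite /transition (negbTE yz) !mul0r.
rewrite ler_wpM2l ?transition_ge0// (emb_sqdist_add x y).
have := emb_dot_le x y z; have := emb_sqdist_edge yz.
have := emb_sqdist_ge0 y z.
set F := f x y in f0 *; set W := w x y z; set D := f y z => D0 Dd WF.
have : D * D <= d%:R * D by rewrite ler_wpM2r.
have : 0 <= (2 * W - D) ^+ 2 by exact: sqr_ge0.
lra.
Qed.

(** Since [d <= rho ^+ 2], every edge is short enough for strong convexity on [f x y <= rho ^+ 2];
    elsewhere plain convexity is used. Mean squared step length 1 turns the gain into
    [1 / (14 * rho)]. *)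
Lemma huber_mean x y (rho : R) : 0 < rho -> d%:R <= rho ^+ 2 ->
  Num.sqrt (rho ^+ 2 + f x y)
   - (1 - lam) / 2 * (f x y / Num.sqrt (rho ^+ 2 + f x y))
   + (f x y <= rho ^+ 2)%R%:R / (14 * rho)
  <= \sum_z p y z * Num.sqrt (rho ^+ 2 + f x z).
Proof.
move=> r0 dr; set H := Num.sqrt (rho ^+ 2 + f x y).
have := mean_affine x y H (H^-1) ((f x y <= rho ^+ 2)%R%:R / (14 * rho)).
have -> : H^-1 * ((1 - lam) / 2 * f x y) = (1 - lam) / 2 * (f x y / H) by ring.
move=> <-; apply: ler_sum => z _; have [yz|yz] := boolP (e y z); last first.
  by rewrite /transition (negbTE yz) !mul0r.
rewrite ler_wpM2l ?transition_ge0// (emb_sqdist_add x y z).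
have Dr := le_trans (emb_sqdist_edge yz) dr.
have Wf := emb_dot_le x y z; have f0 := emb_sqdist_ge0 x y.
have D0 := emb_sqdist_ge0 y z.
have fz0 : 0 <= f x y + 2 * w x y z + f y z.
  by rewrite -emb_sqdist_add emb_sqdist_ge0.
rewrite [H^-1 * _]mulrC [X in _ + X]mulrAC.
case: (boolP (f x y <= rho ^+ 2)) => [fr|_].
  by rewrite mul1r; exact: huber_strongly_convex.
by rewrite !mul0r addr0; exact: huber_convex.
Qed.

(** Eigenfunctions of a symmetric stochastic matrix for [lam != 1] are orthogonal to constants. *)
Lemma Psi_sum0 i : \sum_y Psi i y = 0.
Proof.
have : \sum_y \sum_z p y z * Psi i z = lam * \sum_y Psi i y.
  by rewrite mulr_sumr; apply: eq_bigr => y _; exact: Psi_eigen.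
have -> : \sum_y \sum_z p y z * Psi i z = \sum_y Psi i y.
  rewrite exchange_big/=; apply: eq_bigr => z _.
  rewrite -mulr_suml; under eq_bigr do rewrite (transition_sym R d esym).
  by rewrite (transition_sum R ereg d_gt0) mul1r.
move=> h; have /eqP : (1 - lam) * \sum_y Psi i y = 0 by rewrite mulrBl mul1r {1}h subrr.
by rewrite mulf_eq0 => /orP[|/eqP//]; rewrite subr_eq0 gt_eqF.
Qed.

(** As [Psi] sums to 0, the average of [f x y] over [y] is exactly [(1 - lam)^-1]; each term is at
    most [d * r ^+ 2 <= (d * r) ^+ 2], and counting neighbours along a geodesic gives
    [d * r <= 3 * #|V|]. *)
Lemma relaxation_time_le (x : V) : (1 - lam)^-1 <= 9 * #|V|%:R ^+ 2.
Proof.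
have n0 : (0 : R) < #|V|%:R by rewrite ltr0n; apply/card_gt0P; exists x.
have d1 : (1 : R) <= d%:R by rewrite ler1n.
have eS : \sum_y f x y = #|V|%:R * (1 - lam)^-1.
  under eq_bigr do rewrite emb_sqdistE.
  rewrite sumrB sumr_const -mulr_sumr exchange_big/= [X in 2 * X]big1.
    by rewrite mulr0 subr0 -[LHS]mulr_natl.
  by move=> i _; rewrite -mulr_sumr Psi_sum0 mulr0.
rewrite -(ler_pM2l n0) -eS [leRHS]mulr_natl -sumr_const; apply: ler_sum => y _.
apply: le_trans (emb_sqdist_le_gdist x y) _.
have [g gg] := geodesic_exists econ x y; set r := gdist e x y in gg *.
have : (d * r.+1 <= 3 * #|V|)%N.
  exact: (@geodesic_neighbors _ _ econ esym _ ereg _ _ _ _ _ predT gg).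
rewrite -(ler_nat R) !natrM -natr1.
set D := d%:R in d1 *; set n := #|V|%:R in n0 *; set rr := r%:R => h.
have rr0 : 0 <= rr by [].
have h1 : D * rr <= 3 * n by lra.
have : (D * rr) ^+ 2 <= (3 * n) ^+ 2 by rewrite ler_pXn2r ?nnegrE ?mulr_ge0//; lra.
have : D * rr ^+ 2 <= D * (D * rr ^+ 2).
  by rewrite -[leLHS]mul1r ler_wpM2r ?mulr_ge0 ?sqr_ge0//; lra.
lra.
Qed.

End Embedding.

(** * Moments and occupation times of the walk *)

Section Law.
Variables (R : realType) (V : finType) (e : rel V) (d : nat).
Hypothesis (esym : symmetric e) (econ : connected_graph e) (ereg : regular e d).
Hypothesis d_gt0 : (0 < d)%N.
Local Notation p := (transition R e d).
(* [mu s x y] is the probability that X_0 = x and X_s = y. *)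
Variable mu : nat -> V -> V -> R.
Hypothesis mu_ge0 : forall s x y, 0 <= mu s x y.
Hypothesis mu_sum : forall s, \sum_x \sum_y mu s x y = 1.
Hypothesis mu_diag : forall x y, x != y -> mu 0 x y = 0.
Hypothesis mu_step : forall s x y, mu s.+1 x y = \sum_z mu s x z * p z y.

(** The expectation of [F(X_0, X_s)]; keeping [X_0] as a coordinate accommodates an arbitrary
    initial law. *)
Definition law_mean (s : nat) (F : V -> V -> R) : R :=
  \sum_x \sum_y mu s x y * F x y.

Lemma le_law_mean s (F G : V -> V -> R) :
  (forall x y, F x y <= G x y) -> law_mean s F <= law_mean s G.
Proof. by move=> FG; do 2 (apply: ler_sum => ? _); rewrite ler_wpM2l. Qed.

Lemma law_mean_ge0 s (F : V -> V -> R) :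
  (forall x y, 0 <= F x y) -> 0 <= law_mean s F.
Proof. by move=> F0; do 2 (apply: sumr_ge0 => ? _); rewrite mulr_ge0. Qed.

Lemma law_meanD s (F G : V -> V -> R) :
  law_mean s (fun x y => F x y + G x y) = law_mean s F + law_mean s G.
Proof.
rewrite -big_split/=; apply: eq_bigr => x _; rewrite -big_split/=.
by apply: eq_bigr => y _; rewrite mulrDr.
Qed.

Lemma law_meanZ s (a : R) (F : V -> V -> R) :
  law_mean s (fun x y => a * F x y) = a * law_mean s F.
Proof.
rewrite mulr_sumr; apply: eq_bigr => x _; rewrite mulr_sumr.
by apply: eq_bigr => y _; rewrite mulrCA.
Qed.

Lemma law_mean_cst s (a : R) : law_mean s (fun=> fun=> a) = a.
Proof.
rewrite -[RHS]mul1r -(mu_sum s) mulr_suml; apply: eq_bigr => x _.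
by rewrite mulr_suml.
Qed.

Lemma law_mean_step s (F : V -> V -> R) :
  law_mean s.+1 F = law_mean s (fun x y => \sum_z p y z * F x z).
Proof.
apply: eq_bigr => x _; under eq_bigr do rewrite mu_step mulr_suml.
rewrite exchange_big/=; apply: eq_bigr => z _; rewrite mulr_sumr.
by apply: eq_bigr => y _; rewrite mulrA.
Qed.

Lemma law_mean0 (F : V -> V -> R) (a : R) : (forall x, F x x = a) ->
  law_mean 0 F = a.
Proof.
move=> Fa; rewrite -[RHS](law_mean_cst 0); apply: eq_bigr => x _.
apply: eq_bigr => y _; have [<-|xy] := eqVneq x y; first by rewrite Fa.
by rewrite mu_diag// !mul0r.
Qed.

Lemma law_heat s x y : mu s x y = mu 0 x x * heat R e d x s y.
Proof.
elim: s y => [|s IH] y /=.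
  by have [->|yx] := eqVneq y x; rewrite ?mulr1// mulr0 mu_diag// eq_sym.
rewrite mu_step mulr_sumr; apply: eq_bigr => z _.
by rewrite IH mulrA.
Qed.

Lemma law_returns_le (t : nat) (T := t.+1) : (0 < t)%N -> (T <= 18 * #|V| ^ 2)%N ->
  \sum_(s < T) law_mean s (fun x y => (x == y)%:R) <= 14 * Num.sqrt t%:R.
Proof.
move=> t0 Tn.
have -> : \sum_(s < T) law_mean s (fun x y => (x == y)%:R) =
    \sum_x mu 0 x x * green R e d x T x.
  rewrite exchange_big/=; apply: eq_bigr => x _.
  rewrite mulr_sumr; apply: eq_bigr => s _; rewrite -law_heat.
  rewrite (bigD1 x)//= eqxx mulr1 big1 ?addr0// => y.
  by rewrite eq_sym => /negbTE ->; rewrite mulr0.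
rewrite -[leRHS](@law_mean0 (fun=> fun=> 14 * Num.sqrt t%:R))//.
apply: ler_sum => x _; rewrite (bigD1 x)//= big1 ?addr0; last first.
  by move=> y; rewrite eq_sym => yx; rewrite mu_diag ?mul0r.
rewrite ler_wpM2l//.
have h : green R e d x T x ^+ 2 <= 96 * T%:R := green_diag_le R esym econ ereg d_gt0 x (ltn0Sn t) Tn.
(* Hence the square is at most [192 * t], below [14 ^+ 2 * t]. *)
have T2 : T%:R <= 2 * t%:R :> R by rewrite -natrM ler_nat /T; lia.
rewrite -(@ler_pXn2r _ 2)// ?nnegrE ?green_ge0 ?mulr_ge0 ?sqrtr_ge0//.
rewrite exprMn sqr_sqrtr//; have : 0 <= t%:R :> R by [].
lra.
Qed.

(** Some edge at each vertex is not a loop. This serves the time [t = 1], where no embedding is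
    used. *)
Lemma law_leave_ge : (1 < #|V|)%N ->
  d%:R^-1 <= law_mean 1 (fun x y => (x != y)%:R).
Proof.
move=> V2; rewrite law_mean_step.
rewrite -[leLHS](@law_mean0 (fun=> fun=> d%:R^-1))//.
apply: ler_sum => x _; apply: ler_sum => y _.
have [<-|xy] := eqVneq x y; last by rewrite mu_diag// !mul0r.
apply: ler_wpM2l => //; have [z xz zx] := neighbor_exists econ x V2.
rewrite (bigD1 z)//= zx /transition xz mul1r mulr1 lerDl.
by apply: sumr_ge0 => u _; rewrite mulr_ge0// divr_ge0.
Qed.

Variables (I : finType) (Psi : I -> V -> R) (lam : R).
Hypothesis lam_lt1 : lam < 1.
Hypothesis Psi_eigen : forall i y, \sum_z p y z * Psi i z = lam * Psi i y.
Hypothesis Psi_norm : forall y, \sum_i Psi i y ^+ 2 = (2 * (1 - lam))^-1.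
Local Notation f := (emb_sqdist Psi).

Lemma law_sqdist_step s :
  law_mean s.+1 f = law_mean s f + (1 - (1 - lam) * law_mean s f).
Proof.
rewrite law_mean_step.
transitivity (law_mean s (fun x y => 1 + lam * f x y)).
  apply: eq_bigr => x _; apply: eq_bigr => y _; congr (_ * _).
  exact: emb_sqdist_mean.
by rewrite law_meanD law_meanZ law_mean_cst; ring.
Qed.

Lemma law_sqdist_le s : law_mean s f <= s%:R.
Proof.
elim: s => [|s IH]; first by rewrite (@law_mean0 _ 0)// => x; exact: emb_sqdist_xx.
rewrite law_sqdist_step -natr1.
have : 0 <= (1 - lam) * law_mean s f.
  apply: mulr_ge0; first by rewrite subr_ge0 ltW.
  apply: law_mean_ge0 => x y; exact: emb_sqdist_ge0.
lra.
Qed.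

Lemma law_sqdist_ge s : (1 - lam) * s%:R <= 1 -> s%:R / 2 <= law_mean s f.
Proof.
(* The induction needs this sharper bound: by [law_sqdist_le], the increment at time [s] is at least
   [1 - (1 - lam) * s]. *)
move=> s1; suff : s%:R - (1 - lam) * s%:R * (s%:R - 1) / 2 <= law_mean s f.
  have : (1 - lam) * s%:R * s%:R <= 1 * s%:R by rewrite ler_wpM2r.
  have : 0 <= (1 - lam) * s%:R by rewrite mulr_ge0// subr_ge0 ltW.
  lra.
elim: {s1} s => [|s IH].
  by rewrite (@law_mean0 _ 0); [lra | move=> x; exact: emb_sqdist_xx].
rewrite law_sqdist_step -natr1.
have : (1 - lam) * law_mean s f <= (1 - lam) * s%:R.
  by rewrite ler_wpM2l ?law_sqdist_le// subr_ge0 ltW.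
lra.
Qed.

Lemma law_sqdist_sqr_le s :
  law_mean s (fun x y => f x y ^+ 2) <= 5 * s%:R ^+ 2 + 2 * d%:R * s%:R.
Proof.
elim: s => [|s IH].
  by rewrite (@law_mean0 _ 0) => [|x]; [lra | rewrite emb_sqdist_xx expr0n].
rewrite law_mean_step; apply: (@le_trans _ _ (law_mean s
    (fun x y => f x y ^+ 2 + (10 * f x y + 2 * d%:R)))).
  apply: le_law_mean => x y; rewrite addrA.
  exact: (emb_sqdist_sqr_mean ereg d_gt0 lam_lt1 Psi_eigen Psi_norm).
rewrite !law_meanD law_meanZ law_mean_cst -natr1.
have := law_sqdist_le s; lra.
Qed.

Lemma law_gdist_sqr_ge s : (1 - lam) * s%:R <= 1 ->
  s%:R / (2 * d%:R) <= law_mean s (fun x y => (gdist e x y)%:R ^+ 2).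
Proof.
move=> s1; have d0 : (0 : R) < d%:R by rewrite ltr0n.
rewrite -(ler_pM2l d0) -law_meanZ.
have -> : d%:R * (s%:R / (2 * d%:R)) = s%:R / 2 :> R.
  by field; exact: lt0r_neq0.
apply: le_trans (law_sqdist_ge s1) _; apply: le_law_mean => x y.
exact: (emb_sqdist_le_gdist esym econ ereg d_gt0 lam_lt1 Psi_eigen Psi_norm).
Qed.

(* Paley-Zygmund type lower bound: y >= y^2 - y^4 for y = sqrt f / (6 sqrt t). *)
Lemma law_gdist_ge t : (d <= t)%N -> (1 - lam) * t%:R <= 1 ->
  1 / 20 * Num.sqrt (t%:R / d%:R) <= law_mean t (fun x y => (gdist e x y)%:R).
Proof.
move=> dt t1; have d0 : (0 : R) < d%:R by rewrite ltr0n.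
have t0 : (0 : R) < t%:R by rewrite ltr0n (leq_trans d_gt0).
have dtR : (d%:R <= t%:R :> R) by rewrite ler_nat.
rewrite sqrtrM ?(ltW t0)// sqrtrV ?(ltW d0)//.
set q := Num.sqrt t%:R; set b := Num.sqrt d%:R.
have q0 : 0 < q by rewrite sqrtr_gt0.
have b0 : 0 < b by rewrite sqrtr_gt0.
have q2 : q ^+ 2 = t%:R by rewrite sqr_sqrtr ?ltW.
have b2 : b ^+ 2 = d%:R by rewrite sqr_sqrtr ?ltW.
set a := 6 * q; have a0 : 0 < a by rewrite mulr_gt0.
have pt x y : a ^+ 2 * f x y - f x y ^+ 2 <= b * a ^+ 3 * (gdist e x y)%:R.
  have := emb_sqdist_le_gdist esym econ ereg d_gt0 lam_lt1 Psi_eigen Psi_norm x y.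
  have f0 := emb_sqdist_ge0 Psi x y.
  set D := (gdist e x y)%:R; have D0 : 0 <= D :> R by [].
  have fs : Num.sqrt (f x y) ^+ 2 = f x y by rewrite sqr_sqrtr.
  have g0 := sqrtr_ge0 (f x y); set g := Num.sqrt _ in fs g0.
  rewrite -b2 -exprMn -fs => gD2.
  have bD0 : 0 <= b * D by apply: mulr_ge0 => //; exact: ltW.
  have gD : g <= b * D by rewrite -(@ler_pXn2r _ 2)// nnegrE.
  apply: (@le_trans _ _ (a ^+ 3 * g)); last first.
    by rewrite -mulrA mulrCA ler_wpM2l// exprn_ge0// ltW.
  have [ga|/ltW ag] := leP g a.
    have : a ^+ 2 * g * g <= a ^+ 2 * g * a.
      by apply: ler_wpM2l => //; apply: mulr_ge0 => //; exact: sqr_ge0.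
    have : 0 <= (g ^+ 2) ^+ 2 by exact: sqr_ge0.
    lra.
  have : a ^+ 2 * g ^+ 2 <= g ^+ 2 * g ^+ 2.
    apply: ler_wpM2r; first exact: sqr_ge0.
    by rewrite ler_pXn2r ?nnegrE// ltW.
  have : 0 <= a ^+ 3 * g by apply: mulr_ge0 => //; rewrite exprn_ge0// ltW.
  lra.
have := le_law_mean t pt.
rewrite law_meanZ (_ : law_mean t _ = a ^+ 2 * law_mean t f
    + (-1) * law_mean t (fun x y => f x y ^+ 2)); last first.
  rewrite -!law_meanZ -law_meanD; apply: eq_bigr => x _; apply: eq_bigr => y _.
  by rewrite mulN1r.
have m1 := law_sqdist_ge t1; have m2 := law_sqdist_sqr_le t.
set E := law_mean t (fun x y => (gdist e x y)%:R) => hE.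
have m3 : d%:R * t%:R <= t%:R * t%:R :> R by rewrite ler_wpM2r// ltW.
have m4 : a ^+ 2 * (t%:R / 2) <= a ^+ 2 * law_mean t f.
  by rewrite ler_wpM2l ?sqr_ge0.
(* With [a ^+ 2 = 36 * t] the left side is at least [18 * t ^+ 2 - 7 * t ^+ 2], where 7 uses
   [d <= t]. Then [11 / 216 >= 1 / 20]. *)
have m5 : 11 * q ^+ 4 <= b * a ^+ 3 * E.
  rewrite (_ : q ^+ 4 = t%:R ^+ 2); last by rewrite -q2 -exprM.
  have a2 : a ^+ 2 = 36 * t%:R by rewrite /a exprMn q2; ring.
  rewrite a2 in m4 hE; lra.
have pos : 0 < 20 * b * q ^+ 3 by rewrite !mulr_gt0 ?exprn_gt0.
rewrite -(ler_pM2r pos).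
have -> : 1 / 20 * (q * b^-1) * (20 * b * q ^+ 3) = q ^+ 4.
  by field; exact: lt0r_neq0.
have -> : E * (20 * b * q ^+ 3) = 20 / 216 * (b * a ^+ 3 * E).
  by rewrite /a; field.
have : 0 <= q ^+ 4 by rewrite exprn_ge0 ?ltW.
lra.
Qed.

Lemma law_small_ball t (rho : R) : (0 < t)%N -> (1 - lam) * t%:R <= 1 ->
  0 < rho -> d%:R <= rho ^+ 2 -> rho ^+ 2 <= t%:R ->
  \sum_(s < t.+1) law_mean s (fun x y => (f x y <= rho ^+ 2)%R%:R)
    <= 42 * (rho * Num.sqrt t%:R).
Proof.
move=> tp t1 r0 dr rt; have t0 : (0 : R) < t%:R by rewrite ltr0n.
have tge1 : (1 : R) <= t%:R by rewrite ler1n.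
set q := Num.sqrt t%:R; have q0 : 0 < q by rewrite sqrtr_gt0.
have q2 : q ^+ 2 = t%:R by rewrite sqr_sqrtr ?ltW.
pose h x y := Num.sqrt (rho ^+ 2 + f x y).
pose B s := law_mean s (fun x y => (f x y <= rho ^+ 2)%R%:R).
have q20 : 0 < 2 * q by rewrite mulr_gt0.
have r2 : 0 < rho ^+ 2 by rewrite exprn_gt0.
have f0 x y := emb_sqdist_ge0 Psi x y.
have h0 x y : 0 < h x y by rewrite sqrtr_gt0 ltr_pwDl.
have h2 x y : h x y ^+ 2 = rho ^+ 2 + f x y.
  by rewrite sqr_sqrtr// addr_ge0// ltW.
have amgm (a : R) : a * (2 * q) <= a ^+ 2 + t%:R.
  by have := sqr_ge0 (a - q); rewrite -q2; lra.
(* AM-GM linearizes the square root, so that only the mean of [f] is needed. *)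
have amgm_h x y : h x y <= (2 * q)^-1 * (f x y + (rho ^+ 2 + t%:R)).
  rewrite -(ler_pM2r q20).
  rewrite mulrAC mulVf ?mul1r ?gt_eqF//.
  by have := amgm (h x y); rewrite h2; lra.
have drift x y : f x y / h x y <= (2 * q)^-1 * (f x y + t%:R).
  apply: (@le_trans _ _ (Num.sqrt (f x y))).
    rewrite ler_pdivrMr//; have fs : Num.sqrt (f x y) ^+ 2 = f x y by rewrite sqr_sqrtr.
    rewrite -{1}fs expr2 ler_wpM2l ?sqrtr_ge0//.
    by rewrite ler_wsqrtr// lerDr ltW.
  rewrite -(ler_pM2r q20).
  rewrite mulrAC mulVf ?mul1r ?gt_eqF//.
  by have := amgm (Num.sqrt (f x y)); rewrite sqr_sqrtr.
(* The mean of [h] grows by the occupation term, up to a drift of at most [(1 - lam) / 2 * q]. *)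
have stp s : (s <= t)%N ->
    B s / (14 * rho) <= law_mean s.+1 h - law_mean s h + (1 - lam) / 2 * q.
  move=> st; rewrite law_mean_step.
  have l0 : 0 <= (1 - lam) / 2 by rewrite divr_ge0// subr_ge0 ltW.
  have := @le_law_mean s _ _ (fun x y =>
    huber_mean ereg d_gt0 lam_lt1 Psi_eigen Psi_norm x y r0 dr).
  rewrite (_ : law_mean s _ = law_mean s h
     + - ((1 - lam) / 2) * law_mean s (fun x y => f x y / h x y)
     + (14 * rho)^-1 * B s); last first.
    rewrite -!law_meanZ -!law_meanD; apply: eq_bigr => x _.
    by apply: eq_bigr => y _; rewrite /h; congr (_ * _); ring.
  have e1 : law_mean s (fun x y => f x y / h x y) <= q.
    apply: le_trans (le_law_mean s drift) _.
    rewrite law_meanZ law_meanD law_mean_cst ler_pdivrMl ?mulr_gt0//.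
    have := law_sqdist_le s; have : s%:R <= t%:R :> R by rewrite ler_nat.
    rewrite -q2; lra.
  have := ler_wpM2l l0 e1; lra.
have eh : law_mean t.+1 h <= 2 * q.
  apply: le_trans (le_law_mean t.+1 amgm_h) _.
  rewrite law_meanZ law_meanD law_mean_cst ler_pdivrMl ?mulr_gt0//.
  have := law_sqdist_le t.+1; rewrite -natr1.
  have -> : 2 * q * (2 * q) = 4 * t%:R by rewrite -q2; ring.
  lra.
(* The telescoped growth is at most [2 * q] and the total drift at most [q]; then [42 = 14 * 3]. *)
have tot : \sum_(s < t.+1) B s / (14 * rho) <= 3 * q.
  apply: (@le_trans _ _ (\sum_(s < t.+1)
     (law_mean s.+1 h - law_mean s h + (1 - lam) / 2 * q))).
    by apply: ler_sum => s _; apply: stp; rewrite -ltnS.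
  rewrite big_split/= sumr_const card_ord.
  rewrite -(big_mkord xpredT (fun s => law_mean s.+1 h - law_mean s h)).
  rewrite telescope_sumr// -[_ *+ t.+1]mulr_natl -natr1.
  have : 0 <= law_mean 0 h by apply: law_mean_ge0 => x y; exact: ltW.
  have : (t%:R + 1) * ((1 - lam) / 2 * q) <= q.
    have l0 : 0 <= (1 - lam) / 2 * q.
      by rewrite !mulr_ge0 ?subr_ge0 ?invr_ge0// ltW.
    have : (t%:R + 1) * ((1 - lam) / 2 * q) <= (2 * t%:R) * ((1 - lam) / 2 * q).
      by rewrite ler_wpM2r//; lra.
    have : (1 - lam) * t%:R * q <= 1 * q by rewrite ler_wpM2r// ltW.
    lra.
  lra.
move: tot; rewrite -mulr_suml ler_pdivrMr ?mulr_gt0//.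
lra.
Qed.

Lemma law_gdist_small_ball t (eps : R) : (d <= t)%N -> t%:R <= (1 - lam)^-1 ->
  1 / Num.sqrt t%:R <= eps ->
  \sum_(s < t.+1) law_mean s
     (fun x y => ((gdist e x y)%:R <= eps * Num.sqrt (t%:R / d%:R))%R%:R)
  <= 42 * eps * t%:R.
Proof.
move=> dt tl eps1; have d0 : (0 : R) < d%:R by rewrite ltr0n.
have tp : (0 < t)%N by exact: leq_trans dt.
have t0 : (0 : R) < t%:R by rewrite ltr0n.
have t1 : (1 : R) <= t%:R by rewrite ler1n.
have l0 : 0 < 1 - lam by rewrite subr_gt0.
have ltm : (1 - lam) * t%:R <= 1 by rewrite mulrC -ler_pdivlMr// mul1r.
rewrite sqrtrM ?(ltW t0)// sqrtrV ?(ltW d0)//.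
set q := Num.sqrt t%:R in eps1 *; set b := Num.sqrt d%:R.
have q0 : 0 < q by rewrite sqrtr_gt0.
have b0 : 0 < b by rewrite sqrtr_gt0.
have q2 : q ^+ 2 = t%:R by rewrite sqr_sqrtr ?ltW.
have b2 : b ^+ 2 = d%:R by rewrite sqr_sqrtr ?ltW.
have eps0 : 0 < eps by apply: lt_le_trans eps1; rewrite divr_gt0.
have eq1 : 1 <= eps * q by rewrite -ler_pdivrMr.
have eq0 : 0 <= eps * q by lra.
(* Three regimes: for [eps > 1] each term is at most 1; for [eps * q < b] the radius is below 1 and
   only returns count; otherwise [law_small_ball] applies with [rho = eps * q]. *)
have [epsL|eps_le1] := ltP 1 eps.
  apply: (@le_trans _ _ (\sum_(s < t.+1) 1)).
    apply: ler_sum => s _; rewrite -[leRHS](law_mean_cst s).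
    by apply: le_law_mean => x y; rewrite lern1 leq_b1.
  rewrite sumr_const card_ord -natr1.
  have : 1 * t%:R <= eps * t%:R by rewrite ler_wpM2r// ltW.
  lra.
have [small|large] := ltP (eps * q) b.
  apply: (@le_trans _ _ (\sum_(s < t.+1) law_mean s (fun x y => (x == y)%:R))).
    apply: ler_sum => s _; apply: le_law_mean => x y; rewrite ler_nat.
    have [xy|xy] := eqVneq x y; first exact: leq_b1.
    rewrite leqn0 eqb0 -ltNge mulrA.
    apply: (@lt_le_trans _ _ 1); first by rewrite ltr_pdivrMr// mul1r.
    by rewrite ler1n lt0n gdist_eq0.
  apply: le_trans (law_returns_le tp _) _; last first.
    (* The assumption [eps >= 1 / sqrt t] is what absorbs the bound [14 * q] on returns. *)
    have : q * 1 <= q * (eps * q) by rewrite ler_wpM2l// ltW.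
    rewrite -/q -q2; lra.
  have [x _|V0] := pickP V; last first.
    have := law_mean_cst 0 1; rewrite /law_mean big_pred0// => /eqP.
    by rewrite eq_sym oner_eq0.
  (* So [t <= 9 * #|V| ^ 2], and [t + 1 <= 2 * t] produces the 18 required for returns. *)
  have := relaxation_time_le esym econ ereg d_gt0 lam_lt1 Psi_eigen Psi_norm x.
  rewrite -(ler_nat R) natrM natrX -natr1; lra.
have e2 : (eps * q) ^+ 2 <= t%:R.
  rewrite exprMn q2 -[leRHS]mul1r; apply: ler_wpM2r; first exact: ltW.
  by apply: exprn_ile1 => //; exact: ltW.
apply: le_trans (_ : _ <= 42 * (eps * q * q)) _; last by rewrite -q2; lra.
have dr : d%:R <= (eps * q) ^+ 2.
  by rewrite -b2 ler_pXn2r ?nnegrE// ltW.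
apply: le_trans (law_small_ball tp ltm _ dr e2); last by rewrite mulr_gt0.
apply: ler_sum => s _; apply: le_law_mean => x y; rewrite ler_nat.
have fD := emb_sqdist_le_gdist esym econ ereg d_gt0 lam_lt1 Psi_eigen Psi_norm x y.
set D := (gdist e x y)%:R in fD *; rewrite mulrA ler_pdivlMr//.
case: (boolP (D * b <= eps * q)) => // Db.
suff -> : f x y <= (eps * q) ^+ 2 by [].
apply: le_trans fD _; rewrite -b2 mulrC -exprMn ler_pXn2r ?nnegrE//.
by apply: mulr_ge0 => //; exact: ltW.
Qed.

End Law.

(** * The joint law of the initial and current positions *)

Section WalkLaw.
Variables (R : realType) (V : finType) (e : rel V) (d : nat).
Variables (disp : measure_display) (Omega : measurableType disp).
Variable P : probability Omega R.

Lemma measure_fin_partition (T : finType) (Y : Omega -> T) (B : set Omega) :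
  (forall y, measurable [set w | Y w = y]) -> measurable B ->
  P B = (\sum_y P (B `&` [set w | Y w = y]))%E.
Proof.
move=> mY mB; have {1}-> : B = \bigcup_(y in [set: T]) (B `&` [set w | Y w = y]).
  apply/seteqP; split => [w Bw|w [y _ []]//].
  by exists (Y w).
rewrite measure_fin_bigcup//; last first.
- by move=> y _; apply: measurableI.
- apply/trivIsetP => y z _ _ yz; apply/seteqP; split => // w [[_ /= wy] [_ /= wz]].
  by move: yz; rewrite -wy -wz eqxx.
- exact: finite_finset.
have -> : [set: T] = [set` xpredT] by apply/seteqP; split.
rewrite -(@bigfs _ _ _ _ (index_enum T))// ?index_enum_uniq// => y _.
by rewrite mem_index_enum.
Qed.

Variable X : nat -> Omega -> V.
Hypothesis walk : simple_random_walk e d P X.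

Let mX n x : measurable [set w | X n w = x].
Proof. by case: walk => h _; exact: h. Qed.

Definition joint_law (s : nat) (x y : V) : R :=
  fine (P [set w | X 0%N w = x /\ X s w = y]).

Let mJ s x y : measurable [set w | X 0%N w = x /\ X s w = y].
Proof. exact: (measurableI _ _ (mX 0 x) (mX s y)). Qed.

Lemma joint_lawE s x y :
  P [set w | X 0%N w = x /\ X s w = y] = (joint_law s x y)%:E.
Proof. by rewrite fineK//; apply: fin_num_measure; exact: mJ. Qed.

Lemma joint_law_ge0 s x y : 0 <= joint_law s x y.
Proof. exact/fine_ge0/measure_ge0. Qed.

Lemma joint_law_diag x y : x != y -> joint_law 0 x y = 0.
Proof.
move=> xy; rewrite /joint_law (_ : [set w | _] = set0) ?measure0//.
by apply/seteqP; split => // w [/= -> /eqP]; rewrite (negbTE xy).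
Qed.

Lemma joint_law_sum s : \sum_x \sum_y joint_law s x y = 1.
Proof.
apply: EFin_inj; rewrite -(@probability_setT _ _ _ P).
rewrite (@measure_fin_partition _ (X 0))// -sumEFin; apply: eq_bigr => x _.
rewrite (@measure_fin_partition _ (X s))//; last exact: measurableI.
rewrite -sumEFin; apply: eq_bigr => y _; rewrite -joint_lawE.
by congr (P _); apply/seteqP; split => w /=; tauto.
Qed.

(** The path up to time [n] as one finite-valued variable, because the walk is specified by
    conditioning on whole paths. *)
Definition history (n : nat) (w : Omega) : {ffun 'I_n.+1 -> V} :=
  [ffun i => X (val i) w].

Let history_set (n : nat) (g : {ffun 'I_n.+1 -> V}) :
  [set w | history n w = g] = [set w | forall i, (i <= n)%N -> X i w = g (inord i)].
Proof.
apply/seteqP; split => w /=.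
  by move=> <- i ni; rewrite ffunE /= inordK.
move=> h; apply/ffunP => i; rewrite ffunE h; first by rewrite inord_val.
exact: (leq_ord i).
Qed.

Let mH n (g : {ffun 'I_n.+1 -> V}) : measurable [set w | history n w = g].
Proof.
have -> : [set w | history n w = g] =
    \bigcap_(i in [set: 'I_n.+1]) [set w | X (val i) w = g i].
  apply/seteqP; split => w /=; first by move=> <- i _; rewrite ffunE.
  by move=> h; apply/ffunP => i; rewrite ffunE; exact: h.
by apply: fin_bigcap_measurable => [|i _]; [exact: finite_finset | exact: mX].
Qed.

Lemma joint_law_history n x y : (joint_law n x y)%:E =
  (\sum_(g : {ffun 'I_n.+1 -> V} | (g ord0 == x) && (g ord_max == y))
     P [set w | history n w = g])%E.
Proof.
rewrite -joint_lawE (measure_fin_partition (@mH n) (mJ n x y)) [RHS]big_mkcond/=.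
apply: eq_bigr => g _; case: ifPn => [/andP[/eqP gx /eqP gy]|ngxy].
  congr (P _); apply/seteqP; split => w /=; first by case.
  by move=> hg; split => //; rewrite -gx -gy -hg !ffunE.
rewrite (_ : [set w | X 0%N w = x /\ X n w = y] `&` [set w | history n w = g]
  = classical_sets.set0) ?measure0//; apply/seteqP; split => // w /= [[x0 yn] hg].
by move: ngxy; rewrite -hg !ffunE /= x0 yn !eqxx.
Qed.

(** Split over histories, apply the defining condition of the walk to each, and regroup by the last
    vertex. *)
Lemma joint_law_step s x y :
  joint_law s.+1 x y = \sum_z joint_law s x z * transition R e d z y.
Proof.
apply: EFin_inj; rewrite -joint_lawE -sumEFin.
rewrite (measure_fin_partition (@mH s) (mJ s.+1 x y)).
transitivity (\sum_(g : {ffun 'I_s.+1 -> V} | g ord0 == x)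
    (P [set w | history s w = g] * (transition R e d (g ord_max) y)%:E))%E.
  rewrite [RHS]big_mkcond/=; apply: eq_bigr => g _; case: ifPn => [/eqP gx|ngx].
    case: walk => _ /(_ s (fun i => g (inord i)) y).
    have -> : inord s = ord_max :> 'I_s.+1 by apply: val_inj; rewrite /= inordK.
    rewrite -history_set => <-; congr (P _).
    apply/seteqP; split => w /=.
      move=> [[_ hy] hg]; split => //.
      by have : [set w | history s w = g] w by []; rewrite history_set.
    move=> [hi hy]; have hg : [set w | history s w = g] w by rewrite history_set.
    by split => //; split => //; rewrite -gx -hg ffunE.
  rewrite (_ : [set w | X 0%N w = x /\ X s.+1 w = y] `&` [set w | history s w = g]
    = classical_sets.set0) ?measure0//; apply/seteqP; split => // w /= [[x0 _] hg].
  by move: ngx; rewrite -hg !ffunE /= x0 eqxx.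
rewrite (partition_big (fun g : {ffun 'I_s.+1 -> V} => g ord_max) xpredT)//=.
apply: eq_bigr => z _; rewrite EFinM joint_law_history ge0_sume_distrl; last first.
  by move=> g _; exact: measure_ge0.
by apply: eq_bigr => g /andP[_ /eqP ->].
Qed.

Lemma expectation_law s (F : V -> V -> R) : (forall x y, 0 <= F x y) ->
  'E_P[fun w => F (X 0%N w) (X s w)]%E = (law_mean joint_law s F)%:E.
Proof.
move=> F0; rewrite unlock.
pose A (xy : V * V) := [set w | X 0%N w = xy.1 /\ X s w = xy.2].
transitivity (\int[P]_w \sum_(xy : V * V) ((F xy.1 xy.2)%:E * (\1_(A xy) w)%:E))%E.
  apply: eq_integral => w _; rewrite (bigD1 (X 0%N w, X s w))//= big1.
    by rewrite adde0 indicE mem_set// mule1.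
  move=> [x y] xy; rewrite indicE memNset ?mule0//= => -[/= h1 h2].
  by move: xy; rewrite h1 h2 eqxx.
rewrite ge0_integral_sum//; last 2 first.
- move=> xy; apply: measurable_funeM; apply/measurable_EFinP.
  by apply: measurable_indic; exact: mJ.
- by move=> xy w _; apply: mule_ge0; rewrite lee_fin.
rewrite /law_mean pair_big/= -sumEFin; apply: eq_bigr => -[x y] _ /=.
rewrite ge0_integralZl//; last 2 first.
- by apply/measurable_EFinP; apply: measurable_indic; exact: mJ.
- by rewrite lee_fin.
rewrite integral_indic//; last exact: mJ.
have -> : A (x, y) `&` setT = A (x, y) by apply/seteqP; split => // w [].
by rewrite muleC EFinM; congr (_ * _)%E; exact: joint_lawE.
Qed.

Lemma probability_law s (Q : V -> V -> bool) :
  P [set w | Q (X 0%N w) (X s w)] =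
  (law_mean joint_law s (fun x y => (Q x y)%:R))%:E.
Proof.
rewrite -expectation_law//.
have -> : (fun w => (Q (X 0%N w) (X s w))%:R : R) = \1_[set w | Q (X 0%N w) (X s w)].
  apply/funext => w; rewrite indicE.
  suff -> : (w \in [set w | Q (X 0%N w) (X s w)]) = Q (X 0%N w) (X s w) by [].
  by apply/idP/idP; rewrite inE.
rewrite expectation_indic//.
have -> : [set w | Q (X 0%N w) (X s w)] = \bigcup_(xy in [set xy : V * V | Q xy.1 xy.2])
    [set w | X 0%N w = xy.1 /\ X s w = xy.2].
  apply/seteqP; split => [w /= Qw|w [[x y] /= Qxy [/= -> ->]]//].
  by exists (X 0%N w, X s w).
by apply: fin_bigcup_measurable => [|i _]; [exact: finite_finset | exact: mJ].
Qed.

End WalkLaw.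

(** * Eigenfunctions and averaging over automorphisms *)

Lemma mem_eigenvalues (R : rcfType) (n : nat) (A : 'M[R]_n) (a : R) :
  a \in eigenvalues A -> eigenvalue A a.
Proof.
rewrite mem_sort => /flattenP[s /mapP[b bA ->]].
rewrite mem_nseq => /andP[_ /eqP ->]; rewrite eigenvalue_root_char.
have A0 := monic_neq0 (char_poly_monic A).
by move: bA; rewrite -(polyrcf.roots_on_rootsR A0) => /andP[].
Qed.

Section Eigenfunction.
Variables (R : realType) (V : finType) (e : rel V) (d : nat).
Hypothesis (esym : symmetric e).
Local Notation p := (transition R e d).

(* The hypothesis excludes the junk value 0 of [second_eigenvalue]. *)
Lemma second_eigenfunction (lam := second_eigenvalue (transition_matrix R e d)) :
  lam != 0 -> exists2 psi : V -> R, (exists x, psi x != 0)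
    & forall y, \sum_z p y z * psi z = lam * psi y.
Proof.
move=> lam0; have /mem_eigenvalues/eigenvalueP[v vA v0] :
    lam \in eigenvalues (transition_matrix R e d).
  rewrite mem_nth// ltnNge; apply: contraNN lam0 => sz.
  by rewrite /lam /second_eigenvalue nth_default.
exists (fun x => v 0 (enum_rank x)).
  move/rV0Pn: v0 => [i vi]; exists (enum_val i).
  by rewrite enum_valK.
(* [v] is a row eigenvector; symmetry of [e] makes it an eigenfunction for the action on
   functions. *)
move=> y; have /rowP/(_ (enum_rank y)) := vA; rewrite !mxE => <-.
rewrite (reindex (@enum_val V predT))/=; last exact: onW_bij (enum_val_bij V).
apply: eq_bigr => i _; rewrite !mxE enum_valK enum_rankK mulrC.
by rewrite /transition esym.
Qed.

Hypothesis etrans : vertex_transitive e.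

(* Averaging the eigenfunction over the automorphism group makes the norm of
   the embedding constant; permutations that are not automorphisms
   contribute 0. *)
Lemma exists_embedding (lam : R) (psi : V -> R) : lam < 1 ->
  (exists x, psi x != 0) -> (forall y, \sum_z p y z * psi z = lam * psi y) ->
  exists2 Psi : {perm V} -> V -> R,
    (forall i y, \sum_z p y z * Psi i z = lam * Psi i y)
    & (forall y, \sum_i Psi i y ^+ 2 = (2 * (1 - lam))^-1).
Proof.
move=> lam1 [x0 psi0] psiE.
pose aut (s : {perm V}) : bool := [forall x, forall y, e (s x) (s y) == e x y].
have autP s : reflect (graph_automorphism e s) (aut s).
  apply: (iffP idP) => [/forallP h x y|h].
    by have /forallP/(_ y)/eqP := h x.
  by apply/forallP => x; apply/forallP => y; rewrite h.
pose K y : R := \sum_(s | aut s) psi (s y) ^+ 2.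
(* Composing with an automorphism that takes [x0] to [y] permutes the automorphisms. *)
have KE y : K y = K x0.
  have [tau tauA tauy] := etrans x0 y.
  rewrite /K [RHS](reindex_inj (mulgI tau))/=; apply: eq_big => s.
    apply/autP/autP => sA u v; first by rewrite !permM sA tauA.
    by have := sA ((tau^-1)%g u) ((tau^-1)%g v); rewrite !permM !permKV -[RHS]tauA !permKV.
  by rewrite permM tauy.
have K0 : 0 < K x0.
  rewrite /K (bigD1 1%g)/=; last by apply/autP => x y; rewrite !perm1.
  rewrite perm1 ltr_pwDl ?exprn_even_gt0//.
  by apply: sumr_ge0 => s _; exact: sqr_ge0.
have l0 : 0 < 2 * (1 - lam) by rewrite mulr_gt0// subr_gt0.
pose c : R := Num.sqrt ((2 * (1 - lam))^-1 / K x0).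
have c2 : c ^+ 2 = (2 * (1 - lam))^-1 / K x0.
  by rewrite sqr_sqrtr// divr_ge0// ?invr_ge0 ltW.
exists (fun s y => if aut s then c * psi (s y) else 0).
  move=> s y; case: ifPn => [/autP sA|_]; last first.
    by rewrite mulr0 big1// => z _; rewrite mulr0.
  rewrite mulrCA -psiE mulr_sumr [RHS](reindex_inj (@perm_inj _ s))/=.
  apply: eq_bigr => z _; rewrite /transition sA; ring.
move=> y; rewrite (eq_bigr (fun s => c ^+ 2 * (if aut s then psi (s y) ^+ 2 else 0))).
  rewrite -mulr_sumr -big_mkcond/= -/(K y) KE c2 divfK// gt_eqF//.
by move=> s _; case: ifP => _; rewrite ?exprMn// expr0n/= mulr0.
Qed.

End Eigenfunction.

(** * Assembling the three estimates *)

Lemma probability_sum_le (R : realType) (disp : measure_display)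
    (Omega : measurableType disp) (P : probability Omega R)
    (V : finType) (X : nat -> Omega -> V) (mu : nat -> V -> V -> R)
    (Q : V -> V -> bool) (t : nat) (a : R) :
  (0 < t)%N ->
  (forall s, P [set w | Q (X 0%N w) (X s w)] =
     (law_mean mu s (fun x y => (Q x y)%:R))%:E) ->
  \sum_(s < t.+1) law_mean mu s (fun x y => (Q x y)%:R) <= a * t%:R ->
  ((t%:R^-1)%:E * \sum_(0 <= s < t.+1) P [set w | Q (X 0%N w) (X s w)] <= a%:E)%E.
Proof.
move=> t0 PQ h; have t0R : (0 : R) < t%:R by rewrite ltr0n.
rewrite (eq_bigr _ (fun s _ => PQ s)) big_mkord sumEFin -EFinM lee_fin.
by rewrite ler_pdivrMl// mulrC.
Qed.

Theorem theorem1p2 (R : realType) :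
  exists C C' : R, 0 < C /\ 1 <= C' /\
  forall (V : finType) (e : rel V) (d : nat),
    (1 < #|V|)%N ->
    symmetric e -> connected_graph e -> vertex_transitive e -> regular e d ->
  forall (disp : measure_display) (Omega : measurableType disp)
    (P : probability Omega R) (X : nat -> Omega -> V),
    simple_random_walk e d P X ->
  let lambda := second_eigenvalue (transition_matrix R e d) in
  let D (t : nat) (w : Omega) : R := (gdist e (X 0%N w) (X t w))%:R in
  (forall t : nat, t%:R <= (1 - lambda)^-1 ->
     ((t%:R / (2 * d%:R))%:E <= 'E_P[(fun w => D t w ^+ 2)%R])%E) /\
  (forall t : nat, (d <= t)%N -> t%:R <= (1 - lambda)^-1 ->
     ((C * Num.sqrt (t%:R / d%:R))%:E <= 'E_P[D t])%E /\
     (forall eps : R, 1 / Num.sqrt t%:R <= eps ->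
        ((t%:R^-1)%:E *
           \sum_(0 <= s < t.+1)
              P [set w | (D s w <= eps * Num.sqrt (t%:R / d%:R))%R]
         <= (C' * eps)%:E)%E)).
Proof.
exists (1 / 20), 42; split; first by lra.
split; first by lra.
move=> V e d V2 esym econ etrans ereg disp Omega P X walk lam D.
have [x0 _] : exists x : V, x \in V by apply/card_gt0P; exact: ltnW.
have [z0 xz0 _] := neighbor_exists econ x0 V2.
have d_gt0 : (0 < d)%N by rewrite -(ereg x0); apply/card_gt0P; exists z0.
have d1 : (1 : R) <= d%:R by rewrite ler1n.
pose mu := joint_law P X.
have mu_ge0 : forall s x y, 0 <= mu s x y := joint_law_ge0 P X.
have mu_sum := joint_law_sum walk.
have mu_diag : forall x y, x != y -> mu 0%N x y = 0 := @joint_law_diag _ _ _ _ P X.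
have mu_step := joint_law_step walk.
have ED1 s : 'E_P[D s]%E = (law_mean mu s (fun x y => (gdist e x y)%:R))%:E.
  by rewrite -(expectation_law walk).
have ED2 s : 'E_P[(fun w => D s w ^+ 2)%R]%E =
    (law_mean mu s (fun x y => (gdist e x y)%:R ^+ 2))%:E.
  by rewrite -(expectation_law walk)// => x y; exact: sqr_ge0.
have PD s (r : R) : P [set w | (D s w <= r)%R] =
    (law_mean mu s (fun x y => ((gdist e x y)%:R <= r)%R%:R))%:E.
  exact: (probability_law walk s (fun x y => (gdist e x y)%:R <= r)).
have leave := law_leave_ge econ mu_ge0 mu_sum mu_diag mu_step V2.
have ED1_1 : d%:R^-1 <= law_mean mu 1 (fun x y => (gdist e x y)%:R).
  apply: le_trans leave _; apply: le_law_mean => // x y.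
  by rewrite ler_nat -(gdist_eq0 econ); case: (gdist e x y).
have ED2_1 : d%:R^-1 <= law_mean mu 1 (fun x y => (gdist e x y)%:R ^+ 2).
  apply: le_trans ED1_1 _; apply: le_law_mean => // x y.
  by rewrite -natrX ler_nat; case: (gdist e x y) => // n; rewrite -mulnn leq_pmulr.
(* For [t >= 2] the hypothesis forces [0 < 1 - lam <= 1 / 2]. So [lam] is not the default value 0,
   and it is not 1, where the inverse would be 0. *)
have embed t : (1 < t)%N -> t%:R <= (1 - lam)^-1 ->
    [/\ lam < 1, (1 - lam) * t%:R <= 1 & exists2 Psi : {perm V} -> V -> R,
    (forall i y, \sum_z transition R e d y z * Psi i z = lam * Psi i y)
    & (forall y, \sum_i Psi i y ^+ 2 = (2 * (1 - lam))^-1)].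
  move=> t1 tl; have t2 : (2 : R) <= t%:R by rewrite ler_nat.
  have l0 : 0 < 1 - lam by rewrite -invr_gt0; lra.
  have tl1 : (1 - lam) * t%:R <= 1 by rewrite mulrC -ler_pdivlMr// mul1r.
  have lt1 : lam < 1 by lra.
  split => //; have l2 : (1 - lam) * 2 <= (1 - lam) * t%:R by rewrite ler_pM2l.
  have lam0 : lam != 0 by rewrite gt_eqF//; lra.
  have [psi psi0 psiE] := second_eigenfunction esym lam0.
  exact: exists_embedding psi0 psiE.
split=> [t tl|t dt tl].
  rewrite ED2 lee_fin; case: (ltngtP t 1%N) => [t0|t1|->].
  - move: t0; rewrite ltnS leqn0 => /eqP ->; rewrite mul0r.
    by apply: law_mean_ge0 => // x y; exact: sqr_ge0.
  - have [lt1 tl1 [Psi PsiE Psi2]] := embed t t1 tl.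
    exact: (law_gdist_sqr_ge esym econ ereg d_gt0 mu_ge0 mu_sum mu_diag mu_step
      lt1 PsiE Psi2 tl1).
  - apply: le_trans ED2_1; rewrite mul1r lef_pV2 ?posrE; lra.
have [t1|t1] := ltnP 1 t.
  have [lt1 tl1 [Psi PsiE Psi2]] := embed t t1 tl.
  split=> [|eps eps1].
    rewrite ED1 lee_fin.
    exact: (law_gdist_ge esym econ ereg d_gt0 mu_ge0 mu_sum mu_diag mu_step
      lt1 PsiE Psi2 dt tl1).
  apply: (probability_sum_le (ltnW t1) (fun s => PD s _)).
  exact: (law_gdist_small_ball esym econ ereg d_gt0 mu_ge0 mu_sum mu_diag mu_step
    lt1 PsiE Psi2 dt tl eps1).
(* What remains is [t = d = 1]: the mean distance is at least [1 / d = 1], and the two probabilities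
   sum to at most 2, while [eps >= 1]. *)
have {}t1 : t = 1%N by apply/eqP; rewrite eqn_leq t1 (leq_trans d_gt0).
have {}dt : d = 1%N by apply/eqP; rewrite eqn_leq d_gt0 -{1}t1 dt.
rewrite t1 dt divr1 sqrtr1; split=> [|eps].
  by rewrite ED1 lee_fin; move: ED1_1; rewrite dt invr1; lra.
rewrite divr1 => eps1; apply: (probability_sum_le _ (fun s => PD s _)) => //.
rewrite !big_ord_recl big_ord0.
have le1 s (Q : V -> V -> bool) : law_mean mu s (fun x y => (Q x y)%:R) <= 1.
  rewrite -[leRHS](law_mean_cst mu_sum s); apply: le_law_mean => // x y.
  by rewrite lern1 leq_b1.
have := le1 0%N (fun x y => (gdist e x y)%:R <= eps * 1).
have := le1 1%N (fun x y => (gdist e x y)%:R <= eps * 1).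
rewrite /=; lra.
Qed.
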